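(* Let $\mathcal{G}=(G^{0},\mathcal{G}^{1},r,s)$ be an ultragraph without sinks. The $r$-discrete groupoid $\mathfrak{G}_{\mathcal{G}}$ (the ultrapath groupoid of $\mathcal{G}$) is essentially principal if and only if $\mathcal{G}$ satisfies condition (K): every vertex $v\in G^{0}$ which hosts a loop hosts at least two distinct loops.
   Context: **Ultragraphs.** An ultragraph $\mathcal{G}=(G^{0},\mathcal{G}^{1},r,s)$ consists of countable sets $G^{0}$ (vertices) and $\mathcal{G}^{1}$ (edges), a map $s:\mathcal{G}^{1}\to G^{0}$, and a map $r$ from $\mathcal{G}^{1}$ to the power set of $G^{0}$ with $r(e)\neq\emptyset$ for all $e$. $\mathcal{G}^{0}$ is the smallest collection of subsets of $G^{0}$ containing $\{v\}$ ($v\in G^{0}$) and $r(e)$ ($e\in\mathcal{G}^{1}$) and closed under finite unions and intersections. A sink is a vertex $v$ with $s^{-1}(v)=\emptyset$. **Ultrapaths.** A finite path of positive length is $\alpha=e_1\cdots e_k$ with $e_i\in\mathcal{G}^1$, $s(e_{i+1})\in r(e_i)$; $|\alpha|=k$, $s(\alpha)=s(e_1)$, $r(\alpha)=r(e_k)$. $\mathfrak{p}^\infty$ is the set of infinite paths $e_1e_2\cdots$ (same condition), with $s(\gamma)=s(e_1)$. The set $\mathfrak{p}$ of ultrapaths is the disjoint union of $\{A\in\mathcal{G}^0:A\ne\emptyset\}$ (length $0$, $r(A)=s(A)=A$) and the set of pairs $(\alpha,A)$ with $|\alpha|\ge1$, $\emptyset\neq A\in\mathcal{G}^0$, $A\subseteq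 r(\alpha)$ (length $|\alpha|$, source $s(\alpha)$, range $A$). The product $x\cdot y$ of ultrapaths is defined iff $r(x)\cap s(y)\neq\emptyset$ (a vertex is identified with its singleton): $(\alpha,A)\cdot(\beta,B)=(\alpha\beta,B)$; $A\cdot B=A\cap B$; $A\cdot y=y$ if $|y|\ge1$; $(\alpha,A)\cdot B=(\alpha,A\cap B)$. For $\gamma\in\mathfrak{p}^\infty$ with $s(\gamma)\in r(x)$: $(\alpha,A)\cdot\gamma=\alpha\gamma$ and $A\cdot\gamma=\gamma$. **Ultrapath groupoid.** For $x\in\mathfrak{p}$ let $D_x=\{y\in\mathfrak{p}:y=x\cdot y'\text{ for some }y'\in\mathfrak p\}\cup\{\gamma\in\mathfrak{p}^\infty:\gamma=x\cdot\gamma'\text{ for some }\gamma'\in\mathfrak p^\infty\}$. Give $\mathfrak{p}\cup\mathfrak{p}^\infty$ the topology with subbasis all $D_x$ and their complements. A nonempty $A\in\mathcal{G}^0$ is an ultraset if $\widetilde A=\{B\in\mathcal{G}^0:A\subseteq B\}$ is an ultrafilter (maximal among proper filters in $\mathcal{G}^0$); $A$ is an infinite emitter if $\{e\in\mathcal{G}^1:s(e)\in A\}$ is infinite. $Y_\infty$ is the set of ultrapaths $y$ such that $r(y)$ is an ultraset and an infinite emitter, and $X=Y_\infty\cup\mathfrak{p}^\infty$ with the subspace topology. $\mathfrak{G}_{\mathcal{G}}$ is the set of triples $(x\cdot\mu,|x|-|y|,y\cdot\mu)$ with $x,y\in\mathfrak{p}$, $r(x)=r(y)$, $\mu\in\mathfrak{p}\cup\mathfrak{p}^\infty$,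 the products defined and lying in $X$; multiplication $(a,m,b)(b,n,c)=(a,m+n,c)$, inverse $(a,m,b)^{-1}=(b,-m,a)$, unit space $X$ (via $a\leftrightarrow(a,0,a)$), and topology with basis the sets $\{(x\cdot\mu,|x|-|y|,y\cdot\mu)\in\mathfrak{G}_{\mathcal G}: x\cdot\mu\in U\}$ for $U\subseteq X$ open and $x,y\in\mathfrak{p}$ with $r(x)=r(y)$. **Loops.** A loop based at $v$ is a finite path $\alpha=e_1\cdots e_n$ of positive length with $s(\alpha)=v$, $v\in r(\alpha)$ and $v\ne s(e_i)$ for all $1<i\le n$; then $v$ hosts the loop $\alpha$. **Essentially principal.** A groupoid $G$ is essentially principal if for every nonempty closed invariant subset $F$ of its unit space $G^{(0)}$, the set of points of $F$ with trivial isotropy is dense in $F$. *)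

(* Defs.v *)
From HB Require Import structures.
From mathcomp Require Import all_boot all_order all_algebra.
From mathcomp Require Import all_classical topology.
From mathcomp Require Import zify.
Import GRing.Theory.

Set Implicit Arguments.
Unset Strict Implicit.
Unset Printing Implicit Defensive.

Local Open Scope classical_set_scope.

(* The field [unit_open] says that the unit space, regarded as a set of arrows
   through [idt], carries the relative topology. Continuity of the operations
   plays no role in the definitions below and is not required. *)
Record groupoid := Groupoid {
  arrow : topologicalType;
  unit_space : topologicalType;
  rng : arrow -> unit_space;
  src : arrow -> unit_space;
  idt : unit_space -> arrow;
  mul : forall g h : arrow, src g = rng h -> arrow;
  inv : arrow -> arrow;
  rng_idt : forall u, rng (idt u) = u;
  src_idt : forall u, src (idt u) = u;
  rng_mul : forall g h (gh : src g = rng h), rng (mul gh) = rng g;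
  src_mul : forall g h (gh : src g = rng h), src (mul gh) = src h;
  rng_inv : forall g, rng (inv g) = src g;
  src_inv : forall g, src (inv g) = rng g;
  mul1g : forall g (h : src (idt (rng g)) = rng g), mul h = g;
  mulg1 : forall g (h : src g = rng (idt (src g))), mul h = g;
  mulA : forall g h k (gh : src g = rng h) (hk : src h = rng k)
    (gh_k : src (mul gh) = rng k) (g_hk : src g = rng (mul hk)),
    mul gh_k = mul g_hk;
  mulVg : forall g (h : src (inv g) = rng g), mul h = idt (src g);
  mulgV : forall g (h : src g = rng (inv g)), mul h = idt (rng g);
  unit_open : forall U : set unit_space,
    open U <-> exists2 V : set arrow, open V & U = idt @^-1` V
}.

Section EssentiallyPrincipal.
Variable G : groupoid.

Definition invariant (F : set (unit_space G)) :=
  forall g : arrow G, F (src g) <-> F (rng g).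

Definition isotropy (u : unit_space G) : set (arrow G) :=
  [set g | rng g = u /\ src g = u].

Definition essentially_principal :=
  forall F : set (unit_space G), F !=set0 -> closed F -> invariant F ->
    F `<=` closure (F `&` [set u | isotropy u = [set idt u]]).

End EssentiallyPrincipal.

Record ultragraph := Ultragraph {
  vertex : countType;
  edge : countType;
  esource : edge -> vertex;
  erange : edge -> set vertex;
  erange_neq0 : forall e, erange e !=set0
}.

Section Ultrapaths.
Variable G : ultragraph.
Implicit Types (A B : set (vertex G)) (a b : seq (edge G)).

Definition no_sinks := forall v : vertex G, exists e, esource e = v.

Definition follows : rel (edge G) := [rel e f | esource f \in erange e].

Definition is_loop (v : vertex G) (a : seq (edge G)) :=
  if a is e :: a' then
    [/\ path follows e a', esource e = v, erange (last e a') v &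
        forall f, f \in a' -> esource f <> v]
  else False.

Definition condition_K := forall v : vertex G,
  (exists a, is_loop v a) ->
  exists a b, [/\ a <> b, is_loop v a & is_loop v b].

(* Unions and intersections are binary. Whether the empty set belongs to the
   collection is immaterial: ultrapaths, ultrasets and members of proper filters
   are nonempty. *)
Definition gen_sets : set (set (vertex G)) :=
  smallest [set C | setU_closed C /\ setI_closed C]
    ([set [set v] | v in [set: vertex G]] `|`
     [set erange e | e in [set: edge G]]).

(* An ultrapath is a pair (edges, range); the case [uedges = [::]] encodes the
   ultrapaths of length 0, that is, the nonempty members of [gen_sets]. *)
Definition is_ultrapath a A :=
  [/\ sorted follows a, gen_sets A, A !=set0 &
      if a is e :: a' then A `<=` erange (last e a') else True].

Record ultrapath := Ultrapath {
  uedges : seq (edge G);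
  uset : set (vertex G);
  ultrapathP : is_ultrapath uedges uset
}.
Implicit Types x y z : ultrapath.

Record infpath := Infpath {
  iedge : nat -> edge G;
  infpathP : forall n, follows (iedge n) (iedge n.+1)
}.
Implicit Types g : infpath.

Definition ulength x := size (uedges x).

Definition usource x :=
  if uedges x is e :: _ then [set esource e] else uset x.

Inductive path_space := Fin of ultrapath | Inf of infpath.
Implicit Types mu : path_space.

Definition psource mu :=
  match mu with
  | Fin y => usource y
  | Inf g => [set esource (iedge g 0)]
  end.

Definition composable x mu := uset x `&` psource mu !=set0.

Definition umul_set x y :=
  if uedges y is [::] then uset x `&` uset y else uset y.

Lemma gen_setsI A B : gen_sets A -> gen_sets B -> gen_sets (A `&` B).
Proof.
move=> hA hB C /= [[hU hI] hC].
by apply: (hI _ _ (hA C _) (hB C _)).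
Qed.

Lemma gen_sets1 (v : vertex G) : gen_sets [set v].
Proof. by move=> C [_]; apply; left; exists v. Qed.

Lemma umul_subproof x y : composable x (Fin y) ->
  is_ultrapath (uedges x ++ uedges y) (umul_set x y).
Proof.
case: x => a A [sa gA nA ra]; case: y => b B [sb gB nB rb].
rewrite /composable /psource /usource /umul_set /=.
case: b sb rb => [|e b] sb rb h /=.
  rewrite cats0; split=> //; first exact: gen_setsI.
  by case: a sa ra => // f a _ ra; apply: subset_trans ra => t [].
case: a sa ra => [|f a] sa ra; split=> //=; last by rewrite last_cat.
move: sa sb; rewrite /= cat_path /= => -> ->; rewrite andbT inE.
by apply: ra; case: h => v [Av <-].
Qed.

Definition umul x y (xy : composable x (Fin y)) : ultrapath :=
  Ultrapath (umul_subproof xy).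

Definition prepend a (g : nat -> edge G) (n : nat) : edge G :=
  if (n < size a)%N then nth (g 0%N) a n else g (n - size a)%N.

Lemma iumul_subproof x g : composable x (Inf g) ->
  forall n, follows (prepend (uedges x) (iedge g) n)
                    (prepend (uedges x) (iedge g) n.+1).
Proof.
case: x g => a A [sa gA nA ra] [g gP] [v [/= Av vE]] n.
rewrite /prepend; case: (ltngtP n.+1 (size a)) => na.
- by move/sortedP: sa; apply.
- by rewrite subSn ?gP // -ltnS.
- rewrite na subnn.
  case: a na sa ra {nA} => // e a [->] sa ra.
  by rewrite nth_last /follows /= inE; apply: ra; rewrite -vE.
Qed.

Definition iumul x g (xg : composable x (Inf g)) : infpath :=
  Infpath (iumul_subproof xg).

Definition pmul x mu : composable x mu -> path_space :=
  match mu return composable x mu -> path_space with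
  | Fin y => fun h => Fin (umul h)
  | Inf g => fun h => Inf (iumul h)
  end.

Definition extensions x : set path_space :=
  [set z | exists mu (h : composable x mu), z = pmul h].

HB.instance Definition _ := gen_eqMixin path_space.
HB.instance Definition _ := gen_choiceMixin path_space.
HB.instance Definition _ := @isSubBaseTopological.Build path_space
  (set path_space)
  ([set extensions x | x in [set: ultrapath]] `|`
   [set ~` extensions x | x in [set: ultrapath]]) id.

(* Properness is [~ F set0] rather than [F <> gen_sets]: with a single vertex,
   [set0] need not be in [gen_sets]. *)
Definition is_proper_filter (F : set (set (vertex G))) :=
  [/\ F `<=` gen_sets, F !=set0, ~ F set0, setI_closed F &
      forall A B, F A -> gen_sets B -> A `<=` B -> F B].

Definition is_ultrafilter (F : set (set (vertex G))) :=
  is_proper_filter F /\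
  forall F', is_proper_filter F' -> F `<=` F' -> F' = F.

Definition ultraset A :=
  [/\ gen_sets A, A !=set0 & is_ultrafilter [set B | gen_sets B /\ A `<=` B]].

Definition infinite_emitter A := infinite_set [set e : edge G | A (esource e)].

Definition boundary : set path_space :=
  [set mu | match mu with
            | Fin y => ultraset (uset y) /\ infinite_emitter (uset y)
            | Inf _ => True
            end].

(* The triples (x.mu, |x| - |y|, y.mu). *)
Definition translate x y : set (boundary * int * boundary) :=
  [set t | exists mu (hx : composable x mu) (hy : composable y mu),
    [/\ val t.1.1 = pmul hx,
        t.1.2 = ((ulength x)%:Z - (ulength y)%:Z)%R &
        val t.2 = pmul hy]].

Definition is_uarrow (t : boundary * int * boundary) :=
  exists x y, uset x = uset y /\ translate x y t.

Record uarrow := Uarrow {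
  triple : boundary * int * boundary;
  uarrowP : is_uarrow triple
}.

Definition uarrow_basic (U : set boundary) x y : set uarrow :=
  [set g | U (triple g).1.1 /\ translate x y (triple g)].

Definition uarrow_basis : set (set uarrow) :=
  [set Z | exists U x y,
     [/\ open U, uset x = uset y & Z = uarrow_basic U x y]].

(* A description of the arrows by tail equivalence; see [is_uarrowP]. *)
Definition tail_eq (p : path_space) (m : int) (q : path_space) :=
  match p, q with
  | Fin x, Fin y => uset x = uset y /\ exists i j,
      [/\ (i <= ulength x)%N, (j <= ulength y)%N,
          drop i (uedges x) = drop j (uedges y) & m = (i%:Z - j%:Z)%R]
  | Inf g, Inf h => exists i j,
      (forall n, iedge g (i + n) = iedge h (j + n)) /\ m = (i%:Z - j%:Z)%R
  | _, _ => False
  end.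

Lemma ultrapath_eq x y :
  uedges x = uedges y -> uset x = uset y -> x = y.
Proof.
case: x y => [a A p] [b B q] /= ab AB; subst b B.
by rewrite (Prop_irrelevance p q).
Qed.

Lemma infpath_eq g h : iedge g =1 iedge h -> g = h.
Proof.
case: g h => [g p] [h q] /= /funext gh; subst h.
by rewrite (Prop_irrelevance p q).
Qed.

Lemma boundary_eq (u v : boundary) : val u = val v -> u = v.
Proof. exact: val_inj. Qed.

Lemma translate_tail_eq x y t : translate x y t -> uset x = uset y ->
  tail_eq (val t.1.1) t.1.2 (val t.2).
Proof.
case: t => [[a m] b] /= [[z|g] [hx [hy /= [-> -> ->]]]] xy /=.
  split; first by rewrite /umul_set xy.
  exists (ulength x), (ulength y); rewrite /ulength /= !size_cat !leq_addr.
  by rewrite !drop_size_cat.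
exists (ulength x), (ulength y); split=> // n.
by rewrite /= /prepend !ltnNge !leq_addr /= !addKn.
Qed.

(* The initial segment of length [i], with range shrunk to the source of the
   remaining tail. *)
Definition tail_set a A i :=
  if drop i a is e :: _ then [set esource e] else A.

Lemma take_ultrapath a A i : is_ultrapath a A ->
  is_ultrapath (take i a) (tail_set a A i).
Proof.
case=> sa gA nA ra; rewrite /tail_set.
have sa' : sorted follows (take i a) by apply: take_sorted.
case da: (drop i a) => [|e b].
  by split=> //; rewrite -(cat_take_drop i a) da cats0 in ra.
split=> //; [exact: gen_sets1|by exists (esource e)|].
move: sa sa'; rewrite -{1}(cat_take_drop i a) da.
case: (take i a) => // f c /=.
by rewrite cat_path /= => /and3P[_ + _] _; rewrite inE => ? v ->.
Qed.

Lemma drop_ultrapath a A i : is_ultrapath a A -> is_ultrapath (drop i a) A.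
Proof.
case=> sa gA nA ra; split=> //; first exact: drop_sorted.
move: ra; rewrite -{1}(cat_take_drop i a).
case: (drop i a) => // e b; case: (take i a) => //= f c.
by rewrite last_cat.
Qed.

Lemma take_infpath (g : infpath) i :
  is_ultrapath (mkseq (iedge g) i) [set esource (iedge g i)].
Proof.
split; [|exact: gen_sets1|by exists (esource (iedge g i))|].
  apply/(sortedP (iedge g 0)) => k; rewrite size_mkseq => ki.
  by rewrite !nth_mkseq ?infpathP // ltnW.
case: i => [|i] //; rewrite (_ : mkseq _ _ = iedge g 0 :: mkseq (iedge g \o S) i);
  last by rewrite /mkseq -[iota 0 _]/(0 :: iota (1 + 0) i) iotaDl /= -map_comp.
move=> _ ->; have /set_mem := infpathP g i.
by case: i => [|i] //; rewrite (last_nth (iedge g 0)) size_mkseq /= nth_mkseq.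
Qed.

Lemma drop_infpath (g : infpath) i n :
  follows (iedge g (i + n)) (iedge g (i + n.+1)).
Proof. by rewrite addnS infpathP. Qed.

Lemma tail_eq_translate (a b : boundary) m :
  tail_eq (val a) m (val b) -> is_uarrow (a, m, b).
Proof.
rewrite /is_uarrow /translate /=.
case: (val a) (val b) => [x|g] [y|h] //=.
  case=> xy [i [j [ix jy dxy ->]]].
  pose x' := Ultrapath (take_ultrapath i (ultrapathP x)).
  pose y' := Ultrapath (take_ultrapath j (ultrapathP y)).
  pose z := Ultrapath (drop_ultrapath i (ultrapathP x)).
  have xy' : uset x' = uset y' by rewrite /= /tail_set dxy xy.
  have xz : uset x' = usource z by [].
  have hx : composable x' (Fin z).
    rewrite /composable /psource -xz setIid.
    by case: (ultrapathP x').
  have hy : composable y' (Fin z) by rewrite /composable -xy'.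
  have zE : umul_set x' z = uset x.
    by rewrite /umul_set /= /tail_set; case: drop => //; rewrite setIid.
  exists x', y'; split=> //; exists (Fin z), hx, hy; split=> /=.
  - by congr Fin; apply: ultrapath_eq; rewrite /= ?zE ?cat_take_drop.
  - by rewrite /ulength /= !size_takel.
  - congr Fin; apply: ultrapath_eq; first by rewrite /= dxy cat_take_drop.
    by rewrite /= /umul_set -xy' -/(umul_set x' z) zE.
case=> i [j [gh ->]].
pose x' := Ultrapath (take_infpath g i).
pose y' := Ultrapath (take_infpath h j).
pose z := Infpath (drop_infpath g i).
have gh0 : iedge g i = iedge h j by rewrite -[i]addn0 gh addn0.
have hx : composable x' (Inf z).
  by exists (esource (iedge g i)); rewrite /= addn0.
have hy : composable y' (Inf z).
  by exists (esource (iedge g i)); rewrite /= addn0 gh0.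
exists x', y'; split; first by rewrite /= gh0.
exists (Inf z), hx, hy; split=> /=.
- congr Inf; apply: infpath_eq => n; rewrite /= /prepend size_mkseq.
  by case: ltnP => ni; rewrite ?nth_mkseq // subnKC.
- by rewrite /ulength /= !size_mkseq.
- congr Inf; apply: infpath_eq => n; rewrite /= /prepend size_mkseq.
  by case: ltnP => ni; rewrite ?nth_mkseq // gh subnKC.
Qed.

Lemma is_uarrowP t : is_uarrow t <-> tail_eq (val t.1.1) t.1.2 (val t.2).
Proof.
split; last by case: t => [[a m] b] /tail_eq_translate.
by case=> x [y [xy /translate_tail_eq]]; apply.
Qed.

Lemma tail_eq_refl p : tail_eq p 0%R p.
Proof.
case: p => [x|g] /=; last by exists 0, 0; rewrite subrr.
by split=> //; exists 0, 0; rewrite subrr.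
Qed.

Lemma tail_eq_sym p q m : tail_eq p m q -> tail_eq q (- m)%R p.
Proof.
case: p q => [x|g] [y|h] //=.
  by case=> -> [i [j [? ? ? ->]]]; split=> //; exists j, i; rewrite opprB.
by case=> i [j [gh ->]]; exists j, i; rewrite opprB; split.
Qed.

Lemma tail_eq_trans p q r m n :
  tail_eq p m q -> tail_eq q n r -> tail_eq p (m + n)%R r.
Proof.
case: p q r => [x|g] [y|h] [z|k] //=; last first.
  case=> i [j [gh ->]] [j' [l [hk ->]]].
  exists (i + (maxn j j' - j))%N, (l + (maxn j j' - j'))%N; split.
    move=> s; rewrite -addnA gh addnA subnKC ?leq_maxl //.
    by rewrite -addnA -hk addnA subnKC ?leq_maxr.
  lia.
case=> -> [i [j [ix jy dxy ->]]] [-> [j' [l [jy' lz dyz ->]]]].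
split=> //; exists (i + (maxn j j' - j))%N, (l + (maxn j j' - j'))%N.
have sxy : (ulength x - i = ulength y - j)%N.
  by rewrite /ulength -!size_drop dxy.
have syz : (ulength y - j' = ulength z - l)%N.
  by rewrite /ulength -!size_drop dyz.
split; [lia|lia| |lia].
rewrite [(i + _)%N]addnC [(l + _)%N]addnC -!drop_drop dxy -dyz !drop_drop.
by rewrite !subnK ?leq_maxl ?leq_maxr.
Qed.

Definition pnth (p : path_space) n : option (edge G) :=
  match p with
  | Fin y => onth (uedges y) n
  | Inf g => Some (iedge g n)
  end.

Lemma pnth_pmul x p (h : composable x p) n :
  pnth (pmul h) n =
  if (n < ulength x)%N then onth (uedges x) n else pnth p (n - ulength x).
Proof.
case: p h => [y|g] h /=.
  by rewrite onth_cat.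
rewrite /prepend /ulength; case: ltnP => // nx.
by rewrite onthE (nth_map (iedge g 0)).
Qed.

Lemma pmul_inj_edges x y p q (hx : composable x p) (hy : composable y q) :
  pmul hx = pmul hy -> ulength x = ulength y -> uedges x = uedges y.
Proof.
move=> e l; apply: eq_from_onth_le => n; rewrite -/(ulength x) -/(ulength y) -l maxnn => nx.
by have := pnth_pmul hx n; rewrite e pnth_pmul -l nx.
Qed.

Lemma pmul_drop x z p q (hx : composable x p) (hz : composable z q) :
  pmul hx = pmul hz -> (ulength x <= ulength z)%N ->
  uedges z = uedges x ++ drop (ulength x) (uedges z) /\
  forall n, (n < ulength z - ulength x)%N ->
    onth (drop (ulength x) (uedges z)) n = pnth p n.
Proof.
move=> e l; split.
  rewrite -{1}(cat_take_drop (ulength x) (uedges z)); congr (_ ++ _).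
  apply: eq_from_onth_le => n; rewrite size_takel // maxnn => nx.
  have := pnth_pmul hx n; rewrite e pnth_pmul nx (leq_trans nx l) => <-.
  by rewrite -[in RHS](cat_take_drop (ulength x) (uedges z)) onth_cat size_takel ?nx.
move=> n nl; have := pnth_pmul hx (ulength x + n).
rewrite ltnNge leq_addr /= addKn e pnth_pmul -ltn_subRL nl => <-.
rewrite -[in RHS](cat_take_drop (ulength x) (uedges z)) onth_cat size_takel //.
by rewrite ltnNge leq_addr /= addKn.
Qed.

Lemma composable_head x y (e : edge G) b :
  uedges y = e :: b -> composable x (Fin y) <-> uset x (esource e).
Proof.
rewrite /composable /= /usource => ->; split; first by case=> v [? <-].
by move=> xe; exists (esource e).
Qed.

Lemma pmul_mulA x w p (xw : composable x (Fin w))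
    (h : composable (umul xw) p) :
  exists (wp : composable w p) (h' : composable x (pmul wp)),
    pmul h = pmul h'.
Proof.
have wp : composable w p.
  case: h => v [/= + pv]; rewrite /umul_set => xv; exists v; split=> //.
  by move: xv; case: (uedges w) => [[]|].
exists wp.
have h' : composable x (pmul wp).
  case ew: (uedges w) => [|e b].
    case: p h wp => [y|g] h wp.
      case: h => v /=; rewrite /umul_set ew => -[[xv wv]].
      rewrite /composable /= /usource /= /umul_set ew /=.
      by case: (uedges y) => [|f c] vy; exists v.
    case: h => v /=; rewrite /umul_set ew => -[[xv wv] vE].
    by exists v; split=> //=; rewrite /prepend ew.
  have := (composable_head x ew).1 xw.
  case: p h wp => [y|g] h wp xe.
    by apply/(@composable_head _ _ e (b ++ uedges y)); rewrite //= ew.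
  by exists (esource e); split=> //=; rewrite /prepend ew.
exists h'.
case: p h wp h' => [y|g] h wp h' /=.
  congr Fin; apply: ultrapath_eq; rewrite /= ?catA //.
  rewrite /umul_set /= /umul_set.
  by case: (uedges w) => [|e b]; case: (uedges y) => [|f c] //=; rewrite setIA.
congr Inf; apply: infpath_eq => n /=; rewrite /prepend size_cat nth_cat /=.
case: (ltnP n (size (uedges x))) => nx; first by rewrite ltn_addr //; exact: set_nth_default.
rewrite -ltn_subLR //; case: ifP => // nw; last by rewrite subnDA.
Qed.

Lemma translate_umul x y w (hx : composable x (Fin w))
  (hy : composable y (Fin w)) :
  translate (umul hx) (umul hy) `<=` translate x y.
Proof.
move=> t [p [h1 [h2 [e1 e2 e3]]]].
have [wp [hx' e1']] := pmul_mulA h1; have [wp' [hy' e3']] := pmul_mulA h2.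
rewrite (Prop_irrelevance wp' wp) in hy' e3'.
exists (pmul wp), hx', hy'; split; rewrite ?e1 ?e3 //.
by rewrite e2 /ulength /= !size_cat; lia.
Qed.

Lemma pmul_shrink x z p q (hx : composable x p) (hz : composable z q) :
  pmul hx = pmul hz -> uedges x = uedges z ->
  (uset x `&` uset z) `&` psource p !=set0 /\
  forall x', uedges x' = uedges x -> uset x' = uset x `&` uset z ->
    exists h : composable x' p, pmul h = pmul hx.
Proof.
move=> e xz.
have ne : (uset x `&` uset z) `&` psource p !=set0.
  move: (hx) (hz); case: p q hx hz e => [y|g] [w|h] //= hx hz.
    case=> ee es _ hz'; move: ee es; rewrite xz => /eqP.
    rewrite eqseq_cat // eqxx /= => /eqP; rewrite /umul_set => yw.
    case ey: (uedges y) => [|f b]; rewrite -yw ey => es.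
      case: hx => v [xv /= yv]; exists v; split=> //; split=> //.
      move: yv; rewrite /usource ey => yv.
      by have [] : (uset z `&` uset w) v by rewrite -es.
    exists (esource f); rewrite /usource ey; split=> //.
    by split; [exact: (composable_head x ey).1 hx|
      apply: (composable_head z _).1 hz'; rewrite -yw ey].
  case=> eg [v [xv /= vE]] [u [zu /= uE]]; exists v.
  split=> //; split=> //; suff -> : v = u by [].
  rewrite vE uE; have := congr1 (fun k => k (size (uedges x))) eg.
  by rewrite xz /prepend ltnn subnn => ->.
split=> // x' ex' sx'.
have h : composable x' p by rewrite /composable sx'.
exists h; case: p q hx hz e ne h => [y|g] [w|k] //= hx hz e ne h; last first.
  by congr Inf; apply: infpath_eq => n /=; rewrite ex'.
congr Fin; apply: ultrapath_eq => /=; first by rewrite ex'.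
case: e => ee; move: ee; rewrite xz => /eqP.
rewrite eqseq_cat // eqxx /= => /eqP yw; rewrite /umul_set -yw.
case: (uedges y) => // es; rewrite sx' -setIA [uset z `&` _]setIC setIA es.
by rewrite setIAC setIid.
Qed.

Lemma psource_head p e : pnth p 0 = Some e -> psource p = [set esource e].
Proof.
case: p => [y|g] /=; last by case=> ->.
by rewrite /usource; case: (uedges y) => // f b [->].
Qed.

Lemma translate_join x y z w t :
  uset x = uset y -> uset z = uset w -> (ulength x <= ulength z)%N ->
  translate x y t -> translate z w t ->
  exists x' y', [/\ uset x' = uset y', translate x' y' t &
    translate x' y' `<=` translate x y `&` translate z w].
Proof.
move=> xy zw lxz tx tz; have := tx; have := tz.
case=> q [hz [hw [f1 f2 f3]]] [p [hx [hy [e1 e2 e3]]]].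
have lyw : (ulength y <= ulength w)%N by move: e2 f2 lxz; lia.
have lxy : (ulength z - ulength x = ulength w - ulength y)%N.
  by move: e2 f2 lxz; lia.
rewrite e1 in f1; rewrite e3 in f3.
have [zE zp] := pmul_drop f1 lxz; have [wE wp] := pmul_drop f3 lyw.
have dE : drop (ulength x) (uedges z) = drop (ulength y) (uedges w).
  apply: eq_from_onth_le => n.
  rewrite !size_drop -/(ulength z) -/(ulength w) -lxy maxnn => nl.
  by rewrite zp ?wp -?lxy.
rewrite -dE in wE wp.
case sE: (drop (ulength x) (uedges z)) => [|e b]; rewrite sE in zE wE zp wp.
  rewrite !cats0 in zE wE.
  have [[v [xzv _]] hx'] := pmul_shrink f1 (esym zE).
  have [_ hy'] := pmul_shrink f3 (esym wE).
  have oP : is_ultrapath [::] (uset x `&` uset z).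
    split=> //; last by exists v.
    by apply: gen_setsI; [case: (ultrapathP x)|case: (ultrapathP z)].
  pose o := Ultrapath oP.
  have hxo : composable x (Fin o) by exists v; split=> //; case: xzv.
  have hzo : composable z (Fin o) by exists v; split=> //; case: xzv.
  have hyo : composable y (Fin o) by rewrite /composable -xy.
  have hwo : composable w (Fin o) by rewrite /composable -zw.
  have xzo : umul hxo = umul hzo.
    apply: ultrapath_eq; first by rewrite /= zE.
    by rewrite /= /umul_set /= setIA setIid setICA setIid.
  have ywo : umul hyo = umul hwo.
    apply: ultrapath_eq; first by rewrite /= wE.
    by rewrite /= /umul_set /= -xy -zw setIA setIid setICA setIid.
  exists (umul hxo), (umul hyo); split; first by rewrite /= /umul_set /= xy.
    have [||k kE] := hx' (umul hxo).
    - by rewrite /= cats0.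
    - by rewrite /= /umul_set /= setIA setIid.
    have [||l lE] := hy' (umul hyo).
    - by rewrite /= cats0.
    - by rewrite /= /umul_set /= -xy -zw setIA setIid.
    exists p, k, l; split; rewrite ?kE ?lE //.
    by rewrite e2 /ulength /= !cats0.
  move=> s st; split; first exact: translate_umul st.
  by move: st; rewrite xzo ywo; apply: translate_umul.
pose o := Ultrapath (drop_ultrapath (ulength x) (ultrapathP z)).
have pe : psource p = [set esource e].
  apply: psource_head; rewrite -zp //.
  by rewrite -/(ulength z) -size_drop sE.
have oE : uedges o = e :: b by [].
have hxo : composable x (Fin o).
  by rewrite /composable /= /usource oE -pe.
have hyo : composable y (Fin o) by rewrite /composable -xy.
have xoE : z = umul hxo.
  by apply: ultrapath_eq; rewrite /= /umul_set /= sE.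
have yoE : w = umul hyo.
  by apply: ultrapath_eq; rewrite /= /umul_set /= sE.
exists z, w; split=> // s st; split=> //.
by move: st; rewrite xoE yoE; apply: translate_umul.
Qed.

HB.instance Definition _ := gen_eqMixin uarrow.
HB.instance Definition _ := gen_choiceMixin uarrow.

Lemma uarrow_basis_cover :
  \bigcup_(Z in uarrow_basis) Z = [set: uarrow].
Proof.
rewrite -subTset => k _; have [x [y [xy kxy]]] := uarrowP k.
exists (uarrow_basic setT x y); last by split.
by exists setT, x, y; split=> //; exact: openT.
Qed.

Lemma uarrow_basis_join (Z Z' : set uarrow) (g : uarrow) :
  uarrow_basis Z -> uarrow_basis Z' -> Z g -> Z' g ->
  exists Z'', [/\ uarrow_basis Z'', Z'' g & Z'' `<=` Z `&` Z'].
Proof.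
case=> [U [x [y [oU xy ->]]]] [V [z [w [oV zw ->]]]] [Ug xg] [Vg zg].
have [x' [y' [xy' tg st]]] : exists x' y', [/\ uset x' = uset y',
    translate x' y' (triple g) &
    translate x' y' `<=` translate x y `&` translate z w].
  case: (leqP (ulength x) (ulength z)) => l; first exact: translate_join.
  rewrite setIC; apply: translate_join => //; exact: ltnW.
exists (uarrow_basic (U `&` V) x' y'); split=> //.
  by exists (U `&` V), x', y'; split=> //; exact: openI.
by move=> k [[Uk Vk] /st[]].
Qed.

HB.instance Definition _ := @isBaseTopological.Build uarrow (set uarrow)
  uarrow_basis id uarrow_basis_cover uarrow_basis_join.

Definition urng (g : uarrow) : boundary := (triple g).1.1.
Definition udeg (g : uarrow) : int := (triple g).1.2.
Definition usrc (g : uarrow) : boundary := (triple g).2.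

Lemma uarrow_eq (g h : uarrow) : triple g = triple h -> g = h.
Proof.
case: g h => [s p] [t q] /= st; subst t.
by rewrite (Prop_irrelevance p q).
Qed.

Lemma uidt_subproof (u : boundary) : is_uarrow (u, 0%R, u).
Proof. exact/is_uarrowP/tail_eq_refl. Qed.

Definition uidt (u : boundary) : uarrow := Uarrow (uidt_subproof u).

Lemma uinv_subproof (g : uarrow) : is_uarrow (usrc g, (- udeg g)%R, urng g).
Proof. by apply/is_uarrowP/tail_eq_sym/is_uarrowP/uarrowP. Qed.

Definition uinv (g : uarrow) : uarrow := Uarrow (uinv_subproof g).

Lemma ucomp_subproof (g h : uarrow) : usrc g = urng h ->
  is_uarrow (urng g, (udeg g + udeg h)%R, usrc h).
Proof.
move=> gh; apply/is_uarrowP; apply: (@tail_eq_trans _ (val (usrc g))).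
  exact/is_uarrowP/uarrowP.
by rewrite /= gh; exact/is_uarrowP/uarrowP.
Qed.

Definition ucomp (g h : uarrow) (gh : usrc g = urng h) : uarrow :=
  Uarrow (ucomp_subproof gh).

Lemma open_extensions x : open (extensions x).
Proof.
exists [set extensions x]; last by rewrite bigcup_set1.
by move=> _ ->; apply: (@finI_from1 _ _ _ id); left; exists x.
Qed.

Lemma open_uidt_basic U x y : open U -> uset x = uset y ->
  open (uidt @^-1` uarrow_basic U x y).
Proof.
move=> oU xy; case: (pselect (x = y)) => [<-|nxy].
  rewrite (_ : _ @^-1` _ = U `&` val @^-1` extensions x); last first.
    apply/seteqP; split=> u /= [Uu].
      by case=> p [hx [_ [e _ _]]]; split=> //; exists p, hx.
    by case=> p [hx e]; split=> //; exists p, hx, hx; rewrite subrr.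
  by apply: openI => //; exists (extensions x) => //; exact: open_extensions.
rewrite (_ : _ @^-1` _ = set0); first exact: open0.
rewrite -subset0 => u [_ [p [hx [hy [/= e1 e2 e3]]]]]; apply: nxy.
apply: ultrapath_eq => //; apply: (@pmul_inj_edges _ _ _ _ hx hy).
  by rewrite -e1 -e3.
by move: e2; lia.
Qed.

Lemma uidt_open (U : set boundary) :
  open U <-> exists2 V : set uarrow, open V & U = uidt @^-1` V.
Proof.
split=> [oU|[V [D sD <-] ->]].
  pose T := [set xy : ultrapath * ultrapath | uset xy.1 = uset xy.2].
  exists (\bigcup_(xy in T) uarrow_basic U xy.1 xy.2).
    apply: bigcup_open => -[x y] /= xy.
    exists [set uarrow_basic U x y]; last by rewrite bigcup_set1.
    by move=> _ ->; exists U, x, y.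
  apply/seteqP; split=> u /=; last by case=> -[x y] _ [].
  move=> Uu; have [x [y [xy t]]] := uidt_subproof u.
  by exists (x, y).
rewrite preimage_bigcup; apply: bigcup_open => Z /sD[U' [x [y [oU' xy ->]]]].
exact: open_uidt_basic.
Qed.

Lemma ucomp1g (g : uarrow) (h : usrc (uidt (urng g)) = urng g) :
  ucomp h = g.
Proof. by apply: uarrow_eq; case: g h => [[[u m] v] p] h; rewrite /= add0r. Qed.

Lemma ucompg1 (g : uarrow) (h : usrc g = urng (uidt (usrc g))) :
  ucomp h = g.
Proof. by apply: uarrow_eq; case: g h => [[[u m] v] p] h; rewrite /= addr0. Qed.

Lemma ucompA (g h k : uarrow) (gh : usrc g = urng h) (hk : usrc h = urng k)
    (gh_k : usrc (ucomp gh) = urng k) (g_hk : usrc g = urng (ucomp hk)) :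
  ucomp gh_k = ucomp g_hk.
Proof. by apply: uarrow_eq; rewrite /= /udeg /= addrA. Qed.

Lemma ucompVg (g : uarrow) (h : usrc (uinv g) = urng g) :
  ucomp h = uidt (usrc g).
Proof. by apply: uarrow_eq; rewrite /= /udeg /= addNr. Qed.

Lemma ucompgV (g : uarrow) (h : usrc g = urng (uinv g)) :
  ucomp h = uidt (urng g).
Proof. by apply: uarrow_eq; rewrite /= /udeg /= addrN. Qed.

Definition ultrapath_groupoid : groupoid :=
  @Groupoid uarrow boundary urng usrc uidt ucomp uinv
    (fun=> erefl) (fun=> erefl)
    (fun _ _ _ => erefl) (fun _ _ _ => erefl)
    (fun=> erefl) (fun=> erefl)
    ucomp1g ucompg1 ucompA ucompVg ucompgV uidt_open.

End Ultrapaths.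

(* Main.v *)
(* Finite ultrapaths have trivial isotropy, so only eventually periodic infinite
   paths matter.

   If (K) holds and g in a closed invariant F is eventually periodic, choose
   distinct loops a and b at a vertex v that g visits infinitely often. An initial
   segment of g ending at v followed by an infinite word in a and b is a limit of
   paths that follow finitely many letters and then the tail of g, hence lies in F.
   Cutting at the visits to v recovers the word, so there are uncountably many such
   paths, whereas only countably many paths are eventually periodic.

   Conversely let a be the only loop at v, let e be its first edge and g = aaa...
   A path that starts at v and shares a tail with g equals g. Hence the closed
   invariant set of all points whose orbit meets the cylinder of e in at most {g}
   contains g as an isolated point, and g has nontrivial isotropy. *)
From mathcomp Require Import finmap.
From mathcomp Require Import all_boot all_order all_algebra.
From mathcomp Require Import all_classical topology.
From mathcomp Require Import zify.
Require Import Defs.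

Set Implicit Arguments.
Unset Strict Implicit.
Unset Printing Implicit Defensive.

Local Open Scope classical_set_scope.

(** * Infinite concatenations of words, and aperiodic sequences *)

Section Sequences.
Variable T : Type.
Implicit Types (a b : seq T) (B : nat -> seq T).

(** The infinite word B 0 B 1 ... When no block is empty, the first [n.+1] blocks reach past
    position n, so the default [t0] is never read. *)
Definition stream (t0 : T) B n := nth t0 (flatten (mkseq B n.+1)) n.

Lemma size_flatten_mkseq B k : (forall i, 0 < size (B i)) ->
  k <= size (flatten (mkseq B k)).
Proof.
move=> B0; elim: k => [|k IHk] //.
rewrite mkseqS flatten_rcons size_cat; move: (B0 k); lia.
Qed.

Lemma mkseqD (S : Type) (f : nat -> S) m n :
  mkseq f (m + n) = mkseq f m ++ mkseq (fun i => f (m + i)) n.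
Proof.
rewrite /mkseq iotaD map_cat; congr (_ ++ _).
by rewrite add0n -[in LHS](addn0 m) iotaDl -map_comp.
Qed.

Lemma nth_stream t0 t1 B k n : (forall i, 0 < size (B i)) ->
  n < size (flatten (mkseq B k)) ->
  stream t0 B n = nth t1 (flatten (mkseq B k)) n.
Proof.
move=> B0 nk; have nS := size_flatten_mkseq n.+1 B0; rewrite /stream.
rewrite (set_nth_default t1) //; case: (leqP k n.+1) => kn.
  by rewrite -(subnKC kn) mkseqD flatten_cat nth_cat nk.
by rewrite -(subnKC (ltnW kn)) mkseqD flatten_cat nth_cat nS.
Qed.

Lemma stream_head t0 B n : (forall i, 0 < size (B i)) ->
  stream t0 B n = if n < size (B 0) then nth t0 (B 0) n
                  else stream t0 (fun i => B i.+1) (n - size (B 0)).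
Proof.
move=> B0; rewrite /stream -add1n mkseqD flatten_cat nth_cat /= cats0.
case: ltnP => // Bn; rewrite -(@nth_stream t0) //.
apply: (@leq_trans n); last exact: (size_flatten_mkseq n (fun i => B0 i.+1)).
by have := B0 0; lia.
Qed.

End Sequences.

Lemma cantor_bool (c : (nat -> bool) -> nat) :
  ~ (forall w w', c w = c w' -> w =1 w').
Proof.
(* Cantor's diagonal: by injectivity of c, the only w that [d (c d)] can refer to is d itself. *)
move=> cI; pose d n := ~~ `[< exists2 w, c w = n & w n >].
have [dn|/negP] := boolP (d (c d)).
  by move: (dn) => /asboolP; apply; exists d.
apply; apply/asboolP => -[w /cI wd]; rewrite wd => dn.
by move: (dn) => /asboolP; apply; exists d.
Qed.

(* A sequence with [f (i + n) = f (j + n)] for all n, where [i < j], is determined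
   by i, j and its first j terms. *)
Lemma exists_aperiodic (T : countType) (f : (nat -> bool) -> nat -> T) :
  (forall w w', f w =1 f w' -> w =1 w') ->
  exists w, forall i j, (forall n, f w (i + n) = f w (j + n)) -> i = j.
Proof.
move=> fI; apply: contrapT => nw.
have per w : exists ij : nat * nat, ij.1 < ij.2 /\
    forall n, f w (ij.1 + n) = f w (ij.2 + n).
  apply: contrapT => nij; apply: nw; exists w => i j ij.
  case: (ltngtP i j) => // lij; case: nij; first by exists (i, j).
  by exists (j, i); split=> // n; rewrite ij.
have [k kP] := choice per.
pose code w : nat * nat * seq T := (k w, mkseq (f w) (k w).2).
apply: (@cantor_bool (pickle \o code)) => w w' /(pcan_inj pickleK)[].
have [lw pw] := kP w; have [_ pw'] := kP w'; move=> kw; rewrite -kw in pw' * => fw; apply: fI => n.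
elim/ltn_ind: n => n IHn; case: (ltnP n (k w).2) => nk.
  by have := congr1 (nth (f w 0) ^~ n) fw; rewrite !nth_mkseq.
(* Beyond the recorded prefix, the term at n equals the one a period earlier, where the induction
   hypothesis applies. *)
by rewrite -(subnKC nk) -pw -pw' IHn //; lia.
Qed.

(** * Loops and concatenations of loops *)

Section UltragraphPaths.
Variable G : ultragraph.
Implicit Types (v : vertex G) (a b : seq (edge G)) (g h : infpath G).
Implicit Types (x y z : ultrapath G) (mu : path_space G) (u : @boundary G).

Lemma loop_size v a : is_loop v a -> 0 < size a.
Proof. by case: a. Qed.

Lemma loop_head v a e0 : is_loop v a -> esource (nth e0 a 0) = v.
Proof. by case: a => [|e a] // []. Qed.

Lemma loop_interior v a e0 n : is_loop v a -> 0 < n < size a ->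
  esource (nth e0 a n) <> v.
Proof.
by case: a n => [|e a] [|n] // [_ _ _ aP] /= na; apply: aP; rewrite mem_nth.
Qed.

Lemma path_flatten_loops v e s : erange e v -> (forall a, a \in s -> is_loop v a) ->
  path (@follows G) e (flatten s).
Proof.
elim: s e => [|a s IHs] e ev sP //=.
have := sP a (mem_head _ _); case: a sP => [|f a] // sP [fa fv av _].
rewrite /= cat_path fa IHs // ?andbT; last first.
  by move=> b bs; apply: sP; rewrite inE bs orbT.
by rewrite inE fv.
Qed.

Lemma last_flatten_loops v e s : erange e v -> (forall a, a \in s -> is_loop v a) ->
  erange (last e (flatten s)) v.
Proof.
elim: s e => [|a s IHs] e ev sP //=; rewrite last_cat; apply: IHs.
  have := sP a (mem_head _ _); case: a sP => [|f a] // sP [] //.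
by move=> b bs; apply: sP; rewrite inE bs orbT.
Qed.

(** The range is shrunk to v so that every path starting at v can be appended. *)
Lemma flatten_loops_ultrapath v s : (forall a, a \in s -> is_loop v a) ->
  is_ultrapath (flatten s) [set v].
Proof.
case: s => [|a s] sP; first by split=> //; [exact: gen_sets1|exists v].
have sP' b : b \in s -> is_loop v b by move=> bs; apply: sP; rewrite inE bs orbT.
have := sP a (mem_head _ _); case: a {sP} => [|f a] // [fa fv av _].
split; [|exact: gen_sets1|by exists v|].
  by rewrite /= cat_path fa /=; exact: (path_flatten_loops av sP').
by move=> _ ->; rewrite last_cat; exact: (last_flatten_loops av sP').
Qed.

Lemma stream_infpathP v e0 (B : nat -> seq (edge G)) n : (forall i, is_loop v (B i)) ->
  follows (stream e0 B n) (stream e0 B n.+1).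
Proof.
move=> BP; have B0 i := loop_size (BP i).
(* [n.+2] blocks cover both positions n and [n.+1]. *)
have s2 := size_flatten_mkseq n.+2 B0.
rewrite !(@nth_stream _ e0 e0 B n.+2) //; last exact: ltnW.
have [|/(sortedP e0) + _ _ _] := @flatten_loops_ultrapath v (mkseq B n.+2).
  by move=> a /mapP[i _ ->].
exact.
Qed.

Lemma source_stream v e0 (B : nat -> seq (edge G)) : (forall i, is_loop v (B i)) ->
  esource (stream e0 B 0) = v.
Proof.
move=> BP; rewrite stream_head; last by move=> i; exact: loop_size (BP i).
by rewrite (loop_size (BP 0)) (loop_head _ (BP 0)).
Qed.

Lemma prependl a f n : prepend (G := G) a f (size a + n) = f n.
Proof. by rewrite /prepend ltnNge leq_addr addKn. Qed.

Lemma stream_prepend v e0 (B : nat -> seq (edge G)) : (forall i, is_loop v (B i)) ->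
  stream e0 B =1 prepend (B 0) (stream e0 (fun i => B i.+1)).
Proof.
move=> BP n; rewrite stream_head; last by move=> i; exact: loop_size (BP i).
by rewrite /prepend; case: ltnP => // nB; apply: set_nth_default.
Qed.

(* One loop may be a proper prefix of the other, since the range of an edge can
   contain v together with further vertices; it is the source of the edge after
   the prefix that tells them apart. *)
Lemma prepend_loop_inj v a b (f k : nat -> edge G) :
  is_loop v a -> is_loop v b -> esource (f 0) = v -> esource (k 0) = v ->
  prepend a f =1 prepend b k -> a = b /\ f =1 k.
Proof.
move=> la lb f0 k0 ab.
have sab : size a = size b.
  wlog lt : a b f k la lb f0 k0 ab / size a < size b => [hw|].
    case: (ltngtP (size a) (size b)) => // l; first exact: (hw a b f k).
    by apply/esym; apply: (hw b a k f).
  have := ab (size a); rewrite {2}/prepend lt -{1}[size a]addn0 prependl => fE.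
  have [] := @loop_interior v b (k 0) (size a) lb; last by rewrite -fE.
  by rewrite (loop_size la).
split=> [|n]; last by have := ab (size a + n); rewrite {2}sab !prependl.
apply: (@eq_from_nth _ (f 0)) => // n na.
have := ab n; rewrite /prepend -sab na => ->.
by apply: set_nth_default; rewrite -sab.
Qed.

(** Comparing first blocks yields the first letter of each word and leaves the streams of the
    shifted words. *)
Lemma stream_inj v a b e0 (w w' : nat -> bool) :
  is_loop v a -> is_loop v b -> a <> b ->
  stream e0 (fun i => if w i then a else b) =1
  stream e0 (fun i => if w' i then a else b) -> w =1 w'.
Proof.
move=> la lb nab ww' n; pose B (t : nat -> bool) i := if t i then a else b.
have BP t i : is_loop v (B t i) by rewrite /B; case: ifP.
have step t t' : stream e0 (B t) =1 stream e0 (B t') -> t 0 = t' 0 /\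
    stream e0 (B (fun i => t i.+1)) =1 stream e0 (B (fun i => t' i.+1)).
  move=> tt'.
  have [m|] := prepend_loop_inj (BP t 0) (BP t' 0)
    (source_stream e0 (fun i => BP t i.+1)) (source_stream e0 (fun i => BP t' i.+1)).
    by rewrite -(stream_prepend _ (BP t)) tt' (stream_prepend _ (BP t')).
  by rewrite /B => ab ?; split=> //; move: ab; case: (t 0); case: (t' 0) => // /esym.
by elim: n w w' ww' => [|n IHn] w w' /step[w0 wS] //; exact: IHn wS.
Qed.

(** Take the least positive time at which g is back at v: minimality keeps the interior sources away
    from v. *)
Lemma first_return v g m : esource (iedge g 0) = v ->
  0 < m -> esource (iedge g m) = v ->
  exists k, [/\ 0 < k, is_loop v (mkseq (iedge g) k) & esource (iedge g k) = v].
Proof.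
move=> g0 m0 gm.
have ex : exists k, (0 < k) && `[< esource (iedge g k) = v >].
  by exists m; rewrite m0; apply/asboolP.
case: (ex_minnP ex) => k /andP[k0 /asboolP gk] kmin; exists k; split=> //.
have [sg _ _ rg] := take_infpath g k.
case: k k0 gk kmin sg rg => // k _ gk kmin.
have -> : mkseq (iedge g) k.+1 = iedge g 0 :: mkseq (iedge g \o S) k.
  by rewrite /mkseq -[iota 0 _]/(0 :: iota (1 + 0) k) iotaDl /= -map_comp.
move=> sg rg; split=> //; first exact: rg (esym gk).
move=> f /mapP[i]; rewrite mem_iota /= => ik -> /asboolP gi.
by have := kmin i.+1; rewrite /= gi => /(_ isT); lia.
Qed.

(** * Neighbourhoods of infinite paths, and isotropy *)

Definition drop_path g i : infpath G := Infpath (drop_infpath g i).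

Definition inf_point g : @boundary G :=
  SigSub (mem_set (I : boundary (Inf g))).

(** The edge after x fixes the source of the remaining path, so the first [(ulength x).+1] edges of
    mu decide membership in D_x. Around an infinite path, D_x and its complement are therefore both
    controlled by finitely many edges. *)
Lemma extensionsP x mu e : pnth mu (ulength x) = Some e ->
  extensions x mu <->
  (forall k, k < ulength x -> pnth mu k = onth (uedges x) k) /\ uset x (esource e).
Proof.
move=> mue; split=> [[p [xp E]]|[xk xe]].
  subst mu; split=> [k kx|]; first by rewrite pnth_pmul kx.
  move: mue; rewrite pnth_pmul ltnn subnn => /psource_head pe.
  by case: xp => t [xt]; rewrite pe => <-.
case: mu mue xk => [y|g] /= mue xk.
  have ly : ulength x < ulength y.
    rewrite /ulength ltnNge; apply/negP => xy.
    by move: mue; rewrite onthE nth_default // size_map.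
  have ex : take (ulength x) (uedges y) = uedges x.
    apply: eq_from_onth_le => n; rewrite size_takel ?maxnn; last exact: ltnW.
    by move=> nx; rewrite -xk // -{2}(cat_take_drop (ulength x) (uedges y)) onth_cat
      size_takel ?nx // ltnW.
  pose z := Ultrapath (drop_ultrapath (ulength x) (ultrapathP y)).
  have [b zE] : exists b, uedges z = e :: b.
    move: mue; rewrite -{1}(cat_take_drop (ulength x) (uedges y)) onth_cat.
    rewrite ex ltnn subnn /=; case: (drop _ _) => //= f b [->].
    by exists b.
  have xz : composable x (Fin z) by apply/(composable_head x zE).
  exists (Fin z), xz; congr Fin; apply: ultrapath_eq.
    by rewrite /= -{1}ex cat_take_drop.
  by rewrite /= /umul_set zE.
have xz : composable x (Inf (drop_path g (ulength x))).
  by exists (esource e); split=> //=; rewrite addn0; case: mue => ->.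
exists (Inf (drop_path g (ulength x))), xz; congr Inf; apply: infpath_eq => n /=.
rewrite /prepend; case: ltnP => nx; last by rewrite subnKC.
have := xk n nx; rewrite onthE (nth_map (iedge g 0)) // => -[->].
exact: set_nth_default.
Qed.

Lemma open_infpath g (V : set (path_space G)) : open V -> V (Inf g) ->
  exists n, forall mu, (forall k, k < n -> pnth mu k = Some (iedge g k)) -> V mu.
Proof.
case=> D DP <- [W DW Wg]; have [fs fsP WE] : exists2 fs : {fset (set (path_space G))},
    {subset fs <= [set extensions x | x in [set: ultrapath G]] `|`
      [set ~` extensions x | x in [set: ultrapath G]]} &
    \bigcap_(Y in [set` fs]) Y = W := DP _ DW.
have ex (Y : set (path_space G)) : Y \in fs -> exists n, forall mu,
    (forall k, k < n -> pnth mu k = Some (iedge g k)) -> Y mu.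
  move=> Yfs; have Yg : Y (Inf g) by move: Wg; rewrite -WE; apply.
  have /set_mem [[x _ xY]|[x _ xY]] := fsP _ Yfs; subst Y;
    (* One edge more than x has, because its source must be tested against the range of x. *)
    exists (ulength x).+1 => mu muP.
    apply/(extensionsP (muP _ (ltnSn _))).
    have [xg xs] := (extensionsP (erefl (pnth (Inf g) (ulength x)))).1 Yg.
    by split=> // k kx; rewrite -xg // muP // ltnW.
  move=> xmu; apply: Yg; apply/(extensionsP (erefl (pnth (Inf g) (ulength x)))).
  have [xg xs] := (extensionsP (muP _ (ltnSn _))).1 xmu.
  by split=> // k kx; rewrite -xg // muP // ltnW.
have [N NP] : exists N : set (path_space G) -> nat, forall Y, Y \in fs -> forall mu,
    (forall k, k < N Y -> pnth mu k = Some (iedge g k)) -> Y mu.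
  have [Y|N NP] := @choice _ _ (fun Y n => Y \in fs -> forall mu,
    (forall k, k < n -> pnth mu k = Some (iedge g k)) -> Y mu); last by exists N.
  by case: (boolP (Y \in fs)) => [/ex[n]|_]; [exists n|exists 0].
exists (\max_(Y <- fs) N Y) => mu muP; exists W => //; rewrite -WE.
suff : (\bigcap_(Y in [set` fs]) Y) mu by [].
move=> Y /= Yfs; apply: (NP _ Yfs) => k kN; apply: muP; apply: (leq_trans kN).
exact: leq_bigmax_seq.
Qed.

Lemma nbhs_infpath g u (U : set (@boundary G)) : val u = Inf g -> nbhs u U ->
  exists n, forall w : @boundary G,
    (forall k, k < n -> pnth (val w) k = Some (iedge g k)) -> U w.
Proof.
move=> ug; rewrite nbhsE => -[_ [[V oV <-] /= Vu] sU].
have Vg : V (Inf g) by rewrite -ug.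
have [n nP] := open_infpath oV Vg.
by exists n => w wP; apply: sU; exact: nP.
Qed.

(** An isotropy arrow of nonzero degree identifies two tails of u that start at different positions;
    for a finite ultrapath their lengths would differ. *)
Lemma periodic_isotropy u :
  isotropy (G := ultrapath_groupoid G) u <> [set uidt u] ->
  exists g i j, [/\ val u = Inf g, i < j &
    forall n, iedge g (i + n) = iedge g (j + n)].
Proof.
move=> nu; apply: contrapT => np; apply: nu.
apply/seteqP; split=> [t [/= tr ts]|_ ->] //=.
apply: uarrow_eq; have := uarrowP t; move: tr ts; rewrite /urng /usrc.
case: (triple t) => [[a m] b] /= -> -> /is_uarrowP /=.
case uE: (val u) => [y|g] /=.
  case=> _ [i [j [iy jy ij ->]]]; have := congr1 size ij.
  by rewrite !size_drop -/(ulength y) => ?; congr (_, _, _); lia.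
case=> i [j [ij ->]]; congr (_, _, _).
suff -> : i = j by lia.
case: (ltngtP i j) => // lij; case: np; first by exists g, i, j.
by exists g, j, i; split=> // n; rewrite ij.
Qed.

Lemma invariant_tail (F : set (@boundary G)) g h i j :
  invariant (G := ultrapath_groupoid G) F ->
  (forall n, iedge g (i + n) = iedge h (j + n)) ->
  F (inf_point g) -> F (inf_point h).
Proof.
move=> Finv gh; have t : is_uarrow (inf_point g, (i%:Z - j%:Z)%R, inf_point h).
  by apply/is_uarrowP; exists i, j.
exact: (Finv (Uarrow t)).2.
Qed.


(** * From condition (K) to essential principality *)

Lemma condition_K_essentially_principal :
  condition_K G -> essentially_principal (ultrapath_groupoid G).
Proof.
move=> K F _ Fcl Finv u Fu.
case: (pselect (isotropy (G := ultrapath_groupoid G) u = [set uidt u])) => [tu|].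
  exact: subset_closure.
move=> /periodic_isotropy[g [i [j [ug ij gij]]]] U Unb.
have [n nP] := nbhs_infpath ug Unb.
have gper k : iedge g (i + k * (j - i)) = iedge g i.
  elim: k => [|k IHk]; first by rewrite addn0.
  by rewrite -IHk [RHS]gij; congr iedge; lia.
set v := esource (iedge g i).
have [k [_ lk _]] : exists k, [/\ 0 < k, is_loop v (mkseq (iedge (drop_path g i)) k) &
    esource (iedge (drop_path g i) k) = v].
  apply: (@first_return _ _ (j - i)); rewrite /= ?addn0 ?subn_gt0 //.
  by rewrite -[(j - i)%N]mul1n gper.
have [a [b [nab la lb]]] := K v (ex_intro _ _ lk).
(* A visit of g to v at time n or later: any path agreeing with g before M lies in U. *)
pose M := i + n * (j - i); have nM : n <= M by rewrite /M; nia.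
have gM : esource (iedge g M) = v by rewrite gper.
pose e0 := iedge g 0; pose B (w : nat -> bool) l := if w l then a else b.
have BP w l : is_loop v (B w l) by rewrite /B; case: ifP.
pose s w := Infpath (fun l => stream_infpathP e0 l (BP w)).
pose x := Ultrapath (take_infpath g M).
have xs w : composable x (Inf (s w)).
  by exists v; split; [exact: esym gM|exact: esym (source_stream e0 (BP w))].
pose c w := iumul (xs w).
have cM w l : l < M -> iedge (c w) l = iedge g l.
  by move=> lM; rewrite /= /prepend size_mkseq lM nth_mkseq.
have cS w l : iedge (c w) (M + l) = stream e0 (B w) l.
  by have := prependl (mkseq (iedge g) M) (stream e0 (B w)) l; rewrite size_mkseq.
have Fc w : F (inf_point (c w)).
  apply: Fcl => V /(@nbhs_infpath (c w) (inf_point (c w)) _ erefl)[m mP].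
  (* The approximant of [c w] is x, then [m.+1] loops, then the tail of g from M. Loops are
     nonempty, so the two agree on all positions below m. *)
  have yP := @flatten_loops_ultrapath v (mkseq (B w) m.+1).
  have {}yP : is_ultrapath (flatten (mkseq (B w) m.+1)) [set v].
    by apply: yP => _ /mapP[l _ ->].
  have ym := size_flatten_mkseq m.+1 (fun l => loop_size (BP w l)).
  pose y := Ultrapath yP.
  have yg : composable y (Inf (drop_path g M)).
    by exists v; split=> //=; rewrite addn0 gM.
  have yE l : l <= m -> iedge (iumul yg) l = stream e0 (B w) l.
    move=> lm; rewrite -[LHS]/(prepend (uedges y) _ l) /prepend (leq_trans _ ym) //.
    apply/esym/nth_stream.
      by move=> r; exact: loop_size (BP w r).
    exact: leq_trans ym.
  have xyg : composable x (Inf (iumul yg)).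
    by exists v; split; [exact: esym gM|rewrite /psource yE // (source_stream e0 (BP w))].
  have xygE l : iedge (iumul xyg) (M + l) = iedge (iumul yg) l.
    by have := prependl (uedges x) (iedge (iumul yg)) l; rewrite size_mkseq.
  exists (inf_point (iumul xyg)); split.
    apply: (@invariant_tail F g _ M (M + size (uedges y))) => //.
      by move=> l; rewrite -addnA xygE; exact/esym/prependl.
    rewrite (_ : inf_point g = u) //; exact: val_inj.
  apply: mP => l lm; congr Some; case: (ltnP l M) => lM.
    by rewrite cM // /= /prepend size_mkseq lM nth_mkseq.
  by rewrite -(subnKC lM) cS -yE ?xygE //; lia.
have [|w wP] := @exists_aperiodic _ (fun w => iedge (c w)).
  move=> w w' cw; apply: (stream_inj (e0 := e0) la lb nab) => l.
  by rewrite -[LHS]cS cw cS.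
exists (inf_point (c w)); split; last first.
  by apply: nP => l ln; congr Some; apply: cM; exact: leq_trans nM.
split=> //; apply: contrapT => /periodic_isotropy[h [r [q [[hE] rq per]]]].
by rewrite -hE in per; have := wP _ _ per; lia.
Qed.

(** * From essential principality to condition (K) *)

(** The tail of h visits v, so h returns to v, and its first return cuts off a loop, necessarily a.
    Remove this copy of a and induct on the position. *)
Lemma unique_loop_tail v a e0 h i j :
  is_loop v a -> (forall b, is_loop v b -> b = a) ->
  esource (iedge h 0) = v ->
  (forall n, iedge h (i + n) = stream e0 (fun=> a) (j + n)) ->
  iedge h =1 stream e0 (fun=> a).
Proof.
move=> la ua; have a0 := loop_size la.
have gD n : stream e0 (fun=> a) (size a + n) = stream e0 (fun=> a) n.
  by rewrite (@stream_prepend v) // prependl.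
have gM k : esource (stream e0 (fun=> a) (k * size a)) = v.
  elim: k => [|k IHk]; first exact: source_stream.
  by rewrite mulSn gD.
move=> + + n; elim/ltn_ind: n h => n IHn h h0 hg.
(* This time is chosen to correspond to position (j + 1)|a| of the stream, where a copy of a
   begins. *)
have [|||k [k0 lk hk]] := @first_return v h (i + (j * (size a).-1 + size a)) => //.
- by rewrite !addn_gt0 a0 !orbT.
- rewrite hg -[RHS](gM j.+1); congr (esource (stream _ _ _)).
  by case: (size a) a0 => // r _ /=; rewrite mulSn mulnS; lia.
have aE := ua _ lk; have ka : k = size a by rewrite -aE size_mkseq.
have [na|na] := ltnP n (size a).
  by rewrite stream_head // na -aE nth_mkseq // ka.
(* The shifted path satisfies the hypothesis with the same i and j, since the stream has period
   |a|. *)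
have := IHn (n - size a) _ (drop_path h (size a)).
rewrite /= subnKC // => ->; rewrite ?addn0 -?ka //; first last.
- by move=> m; rewrite addnCA hg addnCA ka gD.
- lia.
by rewrite ka -gD subnKC.
Qed.

(** Exchanging y for x leaves the range of a finite path unchanged, so the new path stays in the
    boundary. *)
Lemma translate_point x y p (hx : composable x p) (hy : composable y p) u :
  uset x = uset y -> val u = pmul hy ->
  exists t : uarrow G, usrc t = u /\ val (urng t) = pmul hx.
Proof.
move=> xy uE; have bx : boundary (pmul hx).
  have := set_mem (valP u); rewrite uE; case: p hx hy {uE} => //= z _ _.
  by rewrite /umul_set xy.
have t : is_uarrow
    (SigSub (mem_set bx) : @boundary G, (ulength x)%:Z - (ulength y)%:Z, u)%R.
  by exists x, y; split=> //; exists p, hx, hy.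
by exists (Uarrow t).
Qed.

Lemma open_setC_extensions x : open (~` extensions x).
Proof.
exists [set ~` extensions x]; last by rewrite bigcup_set1.
by move=> _ ->; apply: (@finI_from1 _ _ _ id); right; exists x.
Qed.

Lemma open_boundary_extensions x : open (val @^-1` extensions x : set (@boundary G)).
Proof. by exists (extensions x) => //; exact: open_extensions. Qed.

(** As t varies, [urng t] runs through the orbit of u, whence the invariance. *)
Definition entry_set (e : edge G) g : set (@boundary G) :=
  [set u | forall t : uarrow G, usrc t = u ->
    pnth (val (urng t)) 0 = Some e -> urng t = inf_point g].

Lemma invariant_entry_set e g :
  invariant (G := ultrapath_groupoid G) (entry_set e g).
Proof.
move=> t; split=> /= tF s st.
  exact: (tF (ucomp (st : usrc s = urng t))).
exact: (tF (ucomp (st : usrc s = urng (uinv t)))).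
Qed.

Lemma edge_ultrapath (e : edge G) : is_ultrapath [:: e] (erange e).
Proof.
split=> //; last exact: erange_neq0.
by move=> C [_]; apply; right; exists e.
Qed.

(** Suppose an arrow t at u ends in the cylinder of e but not at g. Its ultrapaths also move a point
    w of the set close to u into that cylinder, so w is sent to g; closeness of w to u excludes
    this. *)
Lemma closed_entry_set e g : closed (entry_set e g).
Proof.
move=> u uF t tu te; apply: contrapT => tg.
have [x [y [xy [p [hx [hy [tx _ ty]]]]]]] := uarrowP t.
rewrite -/(urng t) in tx; rewrite -/(usrc t) tu in ty.
case: p hx hy tx ty => [z|k] hx hy tx ty; rewrite tx in te.
  (* Near Y every point is Y.p; the companion X.p can only be g if p starts with
     the edge f of g at position |X|, and such points are removed. *)
  pose X := umul hx; pose Y := umul hy.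
  have XY : uset X = uset Y by rewrite /= /umul_set xy.
  pose f := iedge g (ulength X); pose o := Ultrapath (edge_ultrapath f).
  have lY (h : composable Y (Fin o)) : ulength (umul h) = (ulength Y).+1.
    by rewrite /ulength size_cat addn1.
  (* Z is D_{Y.f} if that product is defined, and empty otherwise. *)
  pose Z := [set mu | exists h : composable Y (Fin o), extensions (umul h) mu].
  have oZ : open (val @^-1` (~` Z) : set (@boundary G)).
    exists (~` Z) => //; have [h|nh] := pselect (composable Y (Fin o)).
      rewrite (_ : Z = extensions (umul h)); first exact: open_setC_extensions.
      apply/seteqP; split=> mu; last by exists h.
      by case=> h'; rewrite (Prop_irrelevance h' h).
    rewrite (_ : Z = set0) ?setC0; first exact: openT.
    by rewrite -subset0 => mu [h].
  have Yu : (val @^-1` extensions Y `&` val @^-1` (~` Z)) u.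
    split; rewrite /preimage /= ty.
      have YY : composable Y
          (Fin (Ultrapath (drop_ultrapath (ulength Y) (ultrapathP Y)))).
        rewrite /composable /= /usource /= drop_size setIid.
        by case: (ultrapathP Y).
      exists _, YY; congr Fin; apply: ultrapath_eq => /=.
        by rewrite drop_size cats0.
      by rewrite /umul_set /= drop_size setIid.
    case=> h [p [hp Yp]]; have := pnth_pmul hp (ulength Y).
    rewrite -Yp lY ltnSn [uedges (umul h)]/(uedges Y ++ [:: f]) onth_cat ltnn subnn.
    by rewrite /= -/(uedges Y) onthE nth_default // size_map.
  have [w [wF [[p [hp wE]] wZ]]] := uF _ (open_nbhs_nbhs (conj
     (openI (open_boundary_extensions Y) oZ) Yu)).
  have hXp : composable X p by rewrite /composable XY.
  have [t' [tw tX]] := translate_point hXp XY wE.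
  (* X is the range of t and begins with e, so X.p begins with e too. *)
  have X0 : 0 < ulength X.
    rewrite lt0n; apply/negP => /eqP/size0nil XE.
    by move: te; rewrite [LHS]/(onth (uedges X) 0) XE.
  have tg' : val (urng t') = Inf g.
    by rewrite (wF t') // tX pnth_pmul X0 -te.
  have pE l : pnth p l = Some (iedge g (ulength X + l)).
    have := pnth_pmul hXp (ulength X + l).
    by rewrite -tX tg' ltnNge leq_addr addKn.
  have Yf : uset Y (esource f).
    have := hp; rewrite /composable (psource_head (pE 0)) addn0.
    by case=> v [Yv /= <-].
  have Yo : composable Y (Fin o) by exists (esource f).
  apply: wZ; exists Yo; rewrite wE.
  apply/(@extensionsP _ _ (iedge g (ulength X).+1)).
    by rewrite lY pnth_pmul ltnNge leqnSn subSnn pE addn1.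
  split; last by have /set_mem := infpathP g (ulength X).
  move=> l; rewrite lY ltnS leq_eqVlt pnth_pmul => /predU1P[->|lY'].
    by rewrite ltnn subnn pE addn0 onth_cat ltnn subnn.
  by rewrite lY' [RHS](onth_cat (uedges Y)) -/(ulength Y) lY'.
have [N tN] : exists N, pnth (val (urng t)) N <> Some (iedge g N).
  apply: contrapT => nN; apply: tg; apply: val_inj; rewrite tx.
  congr Inf; apply: infpath_eq => l; apply: contrapT => lg.
  by apply: nN; exists l; rewrite tx => -[].
(* Placed after x, these [N.+1] edges cover position N whatever the length of x. *)
pose o := Ultrapath (take_infpath k N.+1).
have hxo : composable x (Fin o) by [].
have hyo : composable y (Fin o) by [].
have Yu : (val @^-1` extensions (umul hyo)) u.
  rewrite /preimage /= ty.
  have ly : ulength (umul hyo) = ulength y + N.+1.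
    by rewrite /ulength size_cat size_mkseq.
  apply/(@extensionsP _ _ (iedge k N.+1)).
    by rewrite ly pnth_pmul ltnNge leq_addr addKn.
  split=> // l; rewrite ly pnth_pmul onth_cat -/(ulength y) => ll.
  case: ltnP => // yl; rewrite onthE.
  by rewrite (nth_map (iedge k 0)) ?size_mkseq ?nth_mkseq //; lia.
have [w [wF [p [hp wE]]]] := uF _ (open_nbhs_nbhs (conj
  (open_boundary_extensions (umul hyo)) Yu)).
have hxp : composable (umul hxo) p by [].
have [t' [tw tX]] := translate_point hxp (erefl : uset (umul hxo) = uset (umul hyo)) wE.
have tt l : l <= N -> pnth (val (urng t')) l = pnth (val (urng t)) l.
  move=> lN; rewrite tX tx !pnth_pmul {1}/ulength size_cat size_mkseq.
  rewrite ltn_addl // onth_cat -/(ulength x); case: ltnP => // lx.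
  by rewrite onthE (nth_map (iedge k 0)) ?size_mkseq ?nth_mkseq //; lia.
by apply: tN; rewrite -tt // (wF t') // tt // tx.
Qed.

Lemma essentially_principal_condition_K :
  essentially_principal (ultrapath_groupoid G) -> condition_K G.
Proof.
move=> EP v [a la]; apply: contrapT => nab.
have ua b : is_loop v b -> b = a.
  by move=> lb; apply: contrapT => ba; apply: nab; exists b, a.
have [e aE] : exists e, onth a 0 = Some e.
  by case: a la {nab ua} => [|e a] // _; exists e.
have gP n := stream_infpathP (B := fun=> a) e n (fun=> la).
pose g := Infpath gP.
have g0 : iedge g 0 = e.
  by rewrite /= stream_head ?(loop_size la) //; case: (a) aE => // f b [].
have gv : esource e = v by rewrite -g0 (@source_stream v).
have gF : entry_set e g (inf_point g).
  move=> t tg te; have /is_uarrowP := uarrowP t.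
  rewrite -/(urng t) -/(usrc t) tg => tt; apply: val_inj; move: te tt.
  case: (val (urng t)) => // h [he] [i [j [hg _]]].
  congr Inf; apply: infpath_eq.
  by apply: (@unique_loop_tail v a e h i j) => //; rewrite he.
pose x := Ultrapath (edge_ultrapath e).
have xg : (val @^-1` extensions x) (inf_point g).
  apply/(@extensionsP _ _ (iedge g 1)) => //; split=> [[|l]|] //=.
    by move=> _; exact: congr1 g0.
  by have /set_mem := gP 0; rewrite -[stream _ _ 0]/(iedge g 0) g0.
have [u [[uF tu] [p [xp uE]]]] := EP _ (ex_intro _ _ gF) (@closed_entry_set e g)
  (@invariant_entry_set e g) _ gF _
  (open_nbhs_nbhs (conj (open_boundary_extensions x) xg)).
(* The identity arrow shows that u lies in its own orbit, and u begins with e. *)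
have ug : u = inf_point g by apply: (uF (uidt u)) => //=; rewrite uE pnth_pmul.
(* Dropping one copy of a from g gives g again, hence an isotropy arrow of degree |a|. *)
subst u; have t : is_uarrow (inf_point g, Posz (size a), inf_point g).
  apply/is_uarrowP; exists (size a), 0; split=> [n|]; last by rewrite GRing.subr0.
  by rewrite /= (@stream_prepend v) // prependl.
have : isotropy (G := ultrapath_groupoid G) (inf_point g) (Uarrow t) by [].
rewrite tu => /(congr1 (@udeg G)) [].
by have := loop_size la; case: size.
Qed.

End UltragraphPaths.

Theorem theorem31 (G : ultragraph) (hG : no_sinks G) :
  essentially_principal (ultrapath_groupoid G) <-> condition_K G.
Proof.
split; first exact: essentially_principal_condition_K.
exact: condition_K_essentially_principal.
Qed.
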